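(* Let $S$ be the set of degree functions $\deg : \mathbb{C}[X,Y]\to\mathbb{Z}\cup\{-\infty\}$ (where $\mathbb{C}[X,Y]$ is the polynomial ring in two variables) satisfying $\deg(\lambda)=0$ for all $\lambda\in\mathbb{C}^*$, $\deg(X)=2$ and $\deg(Y)=3$. Then there exist elements $d$ and $d'$ of $S$ such that $d|_{\mathbb{Q}[X,Y]}=d'|_{\mathbb{Q}[X,Y]}$, $d$ is $\mathbb{C}$-tame and $d'$ is $\mathbb{C}$-wild.
   Context: A degree function on a ring $B$ with values in a totally ordered abelian group $G$ is a map $\deg : B \to G\cup\{-\infty\}$ such that for all $x,y\in B$: (1) $\deg(x)=-\infty$ iff $x=0$; (2) $\deg(xy)=\deg x+\deg y$; (3) $\deg(x+y)\le\max(\deg x,\deg y)$. For a derivation $D:B\to B$ of an integral domain $B$ with degree function $\deg$, let $U=\{\deg(Dx)-\deg(x) : x\in B\setminus\{0\}\}\subseteq G\cup\{-\infty\}$. If $U$ has a greatest element, $\deg(D)$ is defined to be that element; otherwise $\deg(D)$ is said to be not defined. Let $A\subseteq B$ be integral domains of characteristic zero. A degree function $\deg : B\to G\cup\{-\infty\}$ is $A$-tame (tame over $A$) if $\deg(D)$ is defined for all $A$-derivations $D:B\to B$; otherwise it is $A$-wild. *)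

(* Defs.v *)
From HB Require Import structures.
From mathcomp Require Import all_boot all_order all_algebra.
From mathcomp Require Import classical_sets reals constructive_ereal complex.
Set Implicit Arguments.
Unset Strict Implicit.
Unset Printing Implicit Defensive.
Import Order.TTheory GRing.Theory Num.Theory.
Local Open Scope classical_set_scope.
Local Open Scope ring_scope.

(* ℤ ∪ {-oo} is represented by the extended integers [\bar int] with the value
   +oo excluded by the first field.  On the remaining values the order, maximum
   and addition of [\bar int] are the usual ones, with -oo + z = -oo. *)
Record is_degree_function (B : comNzRingType) (deg : B -> \bar int) : Prop :=
  IsDegreeFunction {
    deg_neq_pinfty : forall x, deg x <> +oo%E ;
    deg_ninftyP : forall x, deg x = -oo%E <-> x = 0 ;
    deg_mul : forall x y, deg (x * y) = (deg x + deg y)%E ;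
    deg_add : forall x y, (deg (x + y)%R <= maxe (deg x) (deg y))%E
  }.

Record is_derivation_over (B : comNzRingType) (A : set B) (D : B -> B) : Prop :=
  IsDerivationOver {
    der_add : forall x y, D (x + y) = D x + D y ;
    der_mul : forall x y, D (x * y) = D x * y + x * D y ;
    der_base : forall a, A a -> D a = 0
  }.

(* The subtracted degree is finite as x != 0, so the difference is never +oo. *)
Definition degree_jumps (B : idomainType) (deg : B -> \bar int) (D : B -> B) :
    set (\bar int) :=
  [set (deg (D x) - deg x)%E | x in [set x : B | x <> 0]].

Definition is_derivation_degree (B : idomainType) (deg : B -> \bar int)
    (D : B -> B) (u : \bar int) : Prop :=
  degree_jumps deg D u /\ ubound (degree_jumps deg D) u.

Definition derivation_degree_defined (B : idomainType) (deg : B -> \bar int)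
    (D : B -> B) : Prop :=
  exists u, is_derivation_degree deg D u.

Definition tame (B : idomainType) (A : set B) (deg : B -> \bar int) : Prop :=
  forall D : B -> B, is_derivation_over A D -> derivation_degree_defined deg D.

Definition wild (B : idomainType) (A : set B) (deg : B -> \bar int) : Prop :=
  ~ tame A deg.

(* K[X,Y] is [{poly {poly K}}], with X the outer variable ['X] and Y the inner
   one ['X%:P]; a constant c of K is embedded as [c%:P%:P]. *)
Definition constants (K : fieldType) : set {poly {poly K}} :=
  range (fun c : K => c%:P%:P).

(* The inclusion of Q[X,Y] in C[X,Y]. *)
Definition ratr_poly2 (R : realType) (q : {poly {poly rat}}) :
    {poly {poly R[i]}} :=
  map_poly (map_poly ratr) q.

Definition S_set (R : realType) : set ({poly {poly R[i]}} -> \bar int) :=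
  [set deg | [/\ is_degree_function deg,
                 forall c : R[i], c <> 0 -> deg c%:P%:P = 0%:E,
                 deg 'X = (2 : int)%:E &
                 deg 'X%:P = (3 : int)%:E]].

(* Main.v *)
From HB Require Import structures.
Require Import Defs.
From mathcomp Require Import all_boot all_order all_algebra.
From mathcomp Require Import classical_sets reals constructive_ereal complex.
From mathcomp Require Import boolp cardinality lebesgue_measure.
From mathcomp Require Import fraction polyXY zify ring.
Set Implicit Arguments.
Unset Strict Implicit.
Unset Printing Implicit Defensive.
Import Order.TTheory GRing.Theory Num.Theory.
Local Open Scope classical_set_scope.
Local Open Scope ring_scope.

(* Take for d the weighted degree with weights (2, 3), that is, the degree in t
   after the substitution X = t^2, Y = u t^3 with u a new variable; it is tame
   because D raises the degree of every monomial by at most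
   max(deg (D X) - 2, deg (D Y) - 3).  Take for d' the degree in t after the
   substitution X = t^2, Y = v t^3, where v = a + \sum_i t^(-2 i!) is a lacunary
   Laurent series in 1/t and a is transcendental over Q.  The gaps of v make it
   transcendental over C(t) (Liouville's argument), so d' is a degree function;
   on Q[X,Y] the leading coefficient is a nonzero rational polynomial in a, so
   d' = d there.  If v_n is a truncation of v, then X^(2 n!) (Y^2 - X^3 v_n^2)
   is a polynomial of very small degree, but its Y-derivative
   2 X^(2 n!) Y is not small, so d/dY has no degree.

   No power series are used: for a fixed polynomial the degree obtained with v_n
   in place of v, computed in the rational functions C(t), is eventually constant
   in n, and d' is defined as this eventual value. *)

Local Notation "x %:F" := (@FracField.tofrac _ x).

(** * Degree functions and fractions *)

Section DegreeFunction.
Variables (B : comNzRingType) (deg : B -> \bar int).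
Hypothesis hdeg : is_degree_function deg.

Lemma deg_zero : deg 0 = -oo%E.
Proof. exact/(deg_ninftyP hdeg). Qed.

Lemma deg_fin x : x <> 0 -> exists z : int, deg x = z%:E.
Proof.
move=> x0; case E: (deg x) => [z| |]; first by exists z.
- by case: (deg_neq_pinfty hdeg E).
- by case: x0; apply/(deg_ninftyP hdeg).
Qed.

Lemma deg_one : deg 1 = 0%:E.
Proof.
have [z Ez] := deg_fin (elimN eqP (oner_neq0 B)).
have := deg_mul hdeg 1 1; rewrite mulr1 Ez => -[] /eqP.
by rewrite -subr_eq subrr => /eqP <-.
Qed.

(** From [(-1) * (-1) = 1] the degree of [-1] is an integer whose double is 0. *)
Lemma deg_opp x : deg (- x) = deg x.
Proof.
have m1 : - 1 <> 0 :> B by apply/eqP; rewrite oppr_eq0 oner_neq0.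
have [z Ez] := deg_fin m1.
have := deg_mul hdeg (-1) (-1); rewrite mulrNN mulr1 deg_one Ez => -[] zz.
have z0 : z = 0 by lia.
by rewrite -mulN1r (deg_mul hdeg) Ez z0 add0e.
Qed.

Lemma deg_sub_le x y : (deg (x - y) <= maxe (deg x) (deg y))%E.
Proof. by rewrite -(deg_opp y); exact: (deg_add hdeg). Qed.

Lemma deg_sum_le (I : Type) (r : seq I) (P : pred I) (F : I -> B) c :
  (forall i, P i -> (deg (F i) <= c)%E) -> (deg (\sum_(i <- r | P i) F i) <= c)%E.
Proof.
move=> H; elim/big_ind: _ => // [|x y hx hy]; first by rewrite deg_zero leNye.
by apply: le_trans (deg_add hdeg _ _) _; rewrite ge_max hx.
Qed.

Lemma deg_addl x y : (deg y < deg x)%E -> deg (x + y) = deg x.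
Proof.
move=> yx; apply/le_anti/andP; split.
  by apply: le_trans (deg_add hdeg _ _) _; rewrite ge_max lexx ltW.
have := deg_sub_le (x + y) y; rewrite addrK le_max.
by rewrite [(deg x <= deg y)%E]leNgt yx orbF.
Qed.

Lemma deg_exp x (z : int) n : deg x = z%:E -> deg (x ^+ n) = (z *+ n)%:E.
Proof.
move=> Ez; elim: n => [|n IHn]; first by rewrite expr0 deg_one mulr0n.
by rewrite exprS (deg_mul hdeg) IHn Ez mulrS.
Qed.

End DegreeFunction.

Section FractionDegree.
Variables (A : idomainType) (deg : A -> \bar int).
Hypothesis hdeg : is_degree_function deg.
Local Notation F := {fraction A}.
Local Notation tofrac := (@FracField.tofrac A).

Lemma fraction_repr (x : F) : x = (\n_(repr x))%:F / (\d_(repr x))%:F.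
Proof.
have d0 : \d_(repr x) != 0 by apply: denom_ratioP.
apply: (canRL (mulfK _)); first by rewrite tofrac_eq0.
rewrite -[x in x * _]reprK /=; move: (repr x) d0 => y d0.
unlock tofrac; rewrite -[LHS]FracField.pi_mul.
apply/eqmodP; rewrite /= /FracField.equivf /FracField.mulf.
by rewrite !numden_Ratio ?mulr1 ?oner_neq0 // mulrC.
Qed.

(** Computed on the chosen representative; [fracdeg_div] shows that any other fraction gives the
    same value. *)
Definition fracdeg (x : F) : \bar int :=
  (deg \n_(repr x) - deg \d_(repr x))%E.

(** Cross-multiply the two fractions and take degrees; both denominators have finite degree, so
    these can be subtracted. *)
Lemma fracdeg_div p q : q <> 0 ->
  fracdeg (p%:F / q%:F) = (deg p - deg q)%E.
Proof.
move=> q0; rewrite /fracdeg; set x := p%:F / _.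
have /eqP := fraction_repr x.
have /eqP d0 : \d_(repr x) != 0 by apply: denom_ratioP.
move: (\n_(repr x)) (\d_(repr x)) d0 => n d d0.
rewrite {}/x eqr_div ?tofrac_eq0; try exact/eqP.
rewrite -!tofracM tofrac_eq => /eqP /(congr1 deg); rewrite !(deg_mul hdeg).
have [dd ->] := deg_fin hdeg d0; have [dq ->] := deg_fin hdeg q0.
by case: (deg p) (deg n) => [u| |] [w| |] //= [] e; congr EFin; lia.
Qed.

Lemma fracdeg_tofrac p : fracdeg p%:F = deg p.
Proof.
rewrite -[p%:F]divr1 -tofrac1 fracdeg_div; last exact/eqP/oner_neq0.
by rewrite (deg_one hdeg) sube0.
Qed.

Lemma fracdeg_is_degree_function : is_degree_function fracdeg.
Proof.
have repr_fin (x : F) : exists z : int, deg \d_(repr x) = z%:E.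
  by apply: (deg_fin hdeg); apply/eqP/denom_ratioP.
split.
- move=> x; rewrite /fracdeg; have [z ->] := repr_fin x.
  by case E: (deg _) => [u| |] //; case: (deg_neq_pinfty hdeg E).
- move=> x; split=> [|->]; last by rewrite -tofrac0 fracdeg_tofrac (deg_zero hdeg).
  rewrite /fracdeg; have [z ->] := repr_fin x.
  case E: (deg _) => [u| |] // _; rewrite (fraction_repr x).
  by rewrite ((deg_ninftyP hdeg _).1 E) tofrac0 mul0r.
- move=> x y; rewrite [in LHS](fraction_repr x) [in LHS](fraction_repr y).
  rewrite mulrACA -invfM -!tofracM fracdeg_div; last first.
    by apply/eqP; rewrite mulf_neq0 ?denom_ratioP.
  rewrite !(deg_mul hdeg) /fracdeg.
  have [z ->] := repr_fin x; have [w ->] := repr_fin y.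
  by case: (deg _) (deg _) => [u| |] [v| |] //=; congr EFin; lia.
- move=> x y; rewrite [in leLHS](fraction_repr x) [in leLHS](fraction_repr y).
  rewrite addf_div ?tofrac_eq0 ?denom_ratioP //.
  rewrite -!tofracM -tofracD fracdeg_div; last first.
    by apply/eqP; rewrite mulf_neq0 ?denom_ratioP.
  have := deg_add hdeg (\n_(repr x) * \d_(repr y)) (\n_(repr y) * \d_(repr x)).
  rewrite !(deg_mul hdeg) /fracdeg.
  have [z ->] := repr_fin x; have [w ->] := repr_fin y.
  (* The finite degree of the common denominator moves to the right, where it is distributed over
     the maximum. *)
  move=> h; rewrite leeBlDr //; apply: le_trans h _.
  rewrite adde_maxl le_eqVlt; apply/orP; left; apply/eqP; congr maxe.
    by case: (deg _) => [u| |] //=; congr EFin; lia.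
  by case: (deg _) => [u| |] //=; congr EFin; lia.
Qed.

End FractionDegree.

(** * The degree of univariate polynomials *)

Section PolynomialDegree.
Variable A : idomainType.

Definition polydeg (p : {poly A}) : \bar int :=
  if p == 0 then -oo%E else (Posz (size p).-1)%:E.

Lemma polydeg_le p n : (polydeg p <= (Posz n)%:E)%E = (size p <= n.+1)%N.
Proof.
rewrite /polydeg; have [->|p0] := eqVneq; first by rewrite leNye size_poly0.
by rewrite lee_fin; move: p0; rewrite -size_poly_gt0; lia.
Qed.

Lemma polydeg_is_degree_function : is_degree_function polydeg.
Proof.
split.
- by move=> x; rewrite /polydeg; case: ifP.
- move=> x; rewrite /polydeg; case: eqVneq => [->|/eqP x0]; first by [].
  by split.
- move=> x y; rewrite /polydeg mulf_eq0.
  have [->|x0] := eqVneq x 0; first by [].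
  have [->|y0] := eqVneq y 0; first by [].
  rewrite /= size_mul //; congr EFin.
  move: x0 y0; rewrite -!size_poly_gt0.
  by case: (size x) => // m; case: (size y) => // n _ _; rewrite addnS.
- move=> x y; rewrite {1}/polydeg; case: ifP => [_|xy0]; first exact: leNye.
  have := size_polyD x y; rewrite leq_max le_max.
  have sxy : (0 < size (x + y)%R)%N by rewrite size_poly_gt0 xy0.
  move=> /orP[] h; apply/orP; [left|right]; rewrite /polydeg -size_poly_eq0;
    move: h (leq_trans sxy h); [case: (size x)|case: (size y)] => // m h _;
    by rewrite /= lee_fin lez_nat -ltnS prednK.
Qed.

End PolynomialDegree.

(** * The weighted degree is tame *)

Lemma bivariate_expansion (A : comNzRingType) (p : {poly {poly A}}) :
  p = \sum_(i < size p) \sum_(j < size p`_i)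
        (p`_i`_j)%:P%:P * 'X%:P ^+ j * 'X ^+ i.
Proof.
rewrite -[LHS]coefK poly_def; apply: eq_bigr => i _.
rewrite -mul_polyC -[p`_i in LHS]coefK poly_def rmorph_sum mulr_suml.
by apply: eq_bigr => j _; rewrite -mul_polyC rmorphM rmorphXn.
Qed.

Section WeightedDegree.
Variable K : fieldType.
Local Notation B := {poly {poly K}}.

(* X |-> t^2 and Y |-> u t^3, with t the outer and u the inner variable. *)
Definition weight_subst (p : B) : B :=
  (map_poly (comp_poly ('X%:P * 'X ^+ 3) \o map_poly polyC) p).['X ^+ 2].

Lemma weight_subst_zmod : zmod_morphism weight_subst.
Proof. by move=> p q; rewrite /weight_subst rmorphB hornerD hornerN. Qed.

Lemma weight_subst_monoid : monoid_morphism weight_subst.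
Proof.
split=> [|p q]; first by rewrite /weight_subst rmorph1 hornerC.
by rewrite /weight_subst rmorphM hornerM.
Qed.

HB.instance Definition _ :=
  GRing.isZmodMorphism.Build B B weight_subst weight_subst_zmod.
HB.instance Definition _ :=
  GRing.isMonoidMorphism.Build B B weight_subst weight_subst_monoid.

Lemma weight_substX : weight_subst 'X = 'X ^+ 2.
Proof. by rewrite /weight_subst map_polyX hornerX. Qed.

Lemma weight_substY : weight_subst 'X%:P = 'X%:P * 'X ^+ 3.
Proof. by rewrite /weight_subst map_polyC hornerC /= map_polyX comp_polyX. Qed.

Lemma weight_substC c : weight_subst c%:P%:P = c%:P%:P.
Proof. by rewrite /weight_subst map_polyC hornerC /= map_polyC comp_polyC. Qed.

(** The monomial [X^i Y^j] becomes [u^j t^(2i+3j)], so only [j = l] contributes to the coefficient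
    of [u^l]. *)
Lemma coef_weight_subst p n l :
  (weight_subst p)`_n`_l = \sum_(i < size p) p`_i`_l *+ (n == 2 * i + 3 * l)%N.
Proof.
rewrite [in LHS](bivariate_expansion p) rmorph_sum !coef_sum.
apply: eq_bigr => i _; rewrite rmorph_sum !coef_sum.
under eq_bigr => j _.
  rewrite !rmorphM !rmorphXn /= weight_substX weight_substY weight_substC.
  rewrite exprMn -!exprM -!mulrA -exprD mulrA -rmorphXn -rmorphM /=.
  rewrite coefCM coefXn mulr_natr coefMn coefCM coefXn mulr_natr.
  over.
have [li|li] := ltnP l (size p`_i); last first.
  rewrite [p`_i`_l]nth_default // mul0rn big1 // => j _.
  by rewrite [l == j]gtn_eqF ?(leq_trans (ltn_ord j)) // !mul0rn.
rewrite (bigD1 (Ordinal li)) //= eqxx mulr1n big1 ?addr0 => [|j jl].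
  by rewrite addnC.
by rewrite [l == j]eq_sym (negbTE (jl : (j : nat) != l)) mul0rn.
Qed.

(** Once [l] is fixed, [2 * i + 3 * l] determines [i]. Distinct monomials thus have distinct images,
    and nothing cancels. *)
Lemma coef_weight_subst_diag p i l :
  (weight_subst p)`_(2 * i + 3 * l)`_l = p`_i`_l.
Proof.
rewrite coef_weight_subst; have [ip|ip] := ltnP i (size p); last first.
  rewrite [p`_i]nth_default // coef0 big1 // => j _.
  case: eqP => // e; have := ltn_ord j; lia.
rewrite (bigD1 (Ordinal ip)) //= eqxx mulr1n big1 ?addr0 => // j /eqP ji.
by case: eqP => // e; case: ji; apply: val_inj => /=; lia.
Qed.

Lemma weight_subst_eq0 p : weight_subst p = 0 -> p = 0.
Proof.
move=> p0; apply/polyP => i; apply/polyP => l.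
by rewrite -coef_weight_subst_diag p0 !coef0.
Qed.

(** This is the degree in [t], with coefficients in [K[u]]; the variable [u] keeps apart monomials
    of equal weight. *)
Definition weighted_degree (p : B) : \bar int := polydeg (weight_subst p).

Lemma weighted_degree_is_degree_function : is_degree_function weighted_degree.
Proof.
have hd := polydeg_is_degree_function {poly K}.
split=> [x|x|x y|x y]; rewrite /weighted_degree.
- exact: (deg_neq_pinfty hd).
- split=> [/(deg_ninftyP hd)|->]; first exact: weight_subst_eq0.
  by rewrite rmorph0 (deg_zero hd).
- by rewrite rmorphM (deg_mul hd).
- by rewrite rmorphD (deg_add hd).
Qed.

Lemma polydeg_C (A : idomainType) (c : A) : c != 0 -> polydeg c%:P = 0%:E.
Proof. by move=> c0; rewrite /polydeg polyC_eq0 (negbTE c0) size_polyC c0. Qed.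

Lemma polydeg_Xn (A : idomainType) n : polydeg ('X ^+ n : {poly A}) = n%:Z%:E.
Proof.
by rewrite /polydeg -size_poly_eq0 size_polyXn.
Qed.

Lemma weighted_degreeC c : c != 0 -> weighted_degree c%:P%:P = 0%:E.
Proof. by move=> c0; rewrite /weighted_degree weight_substC polydeg_C ?polyC_eq0. Qed.

Lemma weighted_degreeX : weighted_degree 'X = 2%:Z%:E.
Proof. by rewrite /weighted_degree weight_substX polydeg_Xn. Qed.

Lemma weighted_degreeY : weighted_degree 'X%:P = 3%:Z%:E.
Proof.
rewrite /weighted_degree weight_substY.
rewrite (deg_mul (polydeg_is_degree_function _)) polydeg_Xn polydeg_C ?add0e //.
by rewrite polyX_eq0.
Qed.

Lemma weighted_degree_coef (p : B) i l :
  p`_i`_l != 0 -> ((2 * i + 3 * l)%:Z%:E <= weighted_degree p)%E.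
Proof.
rewrite -coef_weight_subst_diag => c0; rewrite leNgt; apply/negP.
rewrite /weighted_degree; set q := weight_subst p in c0 *.
rewrite /polydeg; case: eqVneq => [q0|q0]; first by rewrite q0 !coef0 eqxx in c0.
rewrite lte_fin ltz_nat => h; move: c0; rewrite [q`_ _]nth_default ?coef0 ?eqxx //.
by move: h; rewrite -size_poly_gt0 in q0; case: (size q) q0.
Qed.

End WeightedDegree.

(** * Derivations that raise degrees by a bounded amount *)

Section BoundedDerivation.
Variables (B : idomainType) (deg : B -> \bar int) (A : set B) (D : B -> B).
Hypothesis hdeg : is_degree_function deg.
Hypothesis hD : is_derivation_over A D.

Lemma der0 : D 0 = 0.
Proof. by have := der_add hD 0 0; rewrite addr0 => /eqP; rewrite -subr_eq subrr => /eqP. Qed.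

Lemma der1 : D 1 = 0.
Proof.
have := der_mul hD 1 1; rewrite !mulr1 mul1r => /eqP.
by rewrite -subr_eq subrr => /eqP.
Qed.

Lemma der_sum (I : Type) (r : seq I) (P : pred I) (F : I -> B) :
  D (\sum_(i <- r | P i) F i) = \sum_(i <- r | P i) D (F i).
Proof. exact: (big_morph D (der_add hD) der0). Qed.

(** The additive form, unlike a difference of degrees, also makes sense at [x = 0]. *)
Definition raises_degree_by (M : int) (x : B) :=
  (deg (D x) <= deg x + M%:E)%E.

Lemma raises_degree_byM M x y :
  raises_degree_by M x -> raises_degree_by M y -> raises_degree_by M (x * y).
Proof.
rewrite /raises_degree_by => hx hy; rewrite (der_mul hD).
apply: le_trans (deg_add hdeg _ _) _; rewrite ge_max !(deg_mul hdeg).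
apply/andP; split.
  by rewrite addeAC leeD2r.
by rewrite -addeA leeD2l.
Qed.

Lemma raises_degree_by0 M x : D x = 0 -> raises_degree_by M x.
Proof. by move=> h; rewrite /raises_degree_by h (deg_zero hdeg) leNye. Qed.

Lemma raises_degree_byX M x n :
  raises_degree_by M x -> raises_degree_by M (x ^+ n).
Proof.
move=> hx; elim: n => [|n IHn]; first exact/raises_degree_by0/der1.
by rewrite exprS; apply: raises_degree_byM.
Qed.

(** A nonempty set of integers bounded above has a greatest element, so a bound on the jumps is
    enough. *)
Lemma bounded_derivation_degree_defined M :
  (forall x, raises_degree_by M x) -> derivation_degree_defined deg D.
Proof.
move=> hM.
have jump_le x : x <> 0 -> (deg (D x) - deg x <= M%:E)%E.
  move=> /(deg_fin hdeg)[z Ez]; have := hM x; rewrite /raises_degree_by Ez.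
  by rewrite leeBlDr // addeC.
(* A finite jump is coded by its distance [n] below [M]; the least such [n] gives the greatest
   jump. *)
pose P n := `[< exists2 x, x <> 0 & (deg (D x) - deg x)%E = (M - n%:Z)%:E >].
have jumpP x : x <> 0 ->
    (deg (D x) - deg x)%E = -oo%E \/
    exists2 n, P n & (deg (D x) - deg x)%E = (M - n%:Z)%:E.
  move=> x0; have := jump_le x x0; case E: (_ - _)%E => [z| |] // zM; last by left.
  right; exists `|M - z|%N; last by move: zM; rewrite lee_fin => zM; congr EFin; lia.
  apply/asboolP; exists x => //; rewrite E.
  by move: zM; rewrite lee_fin => zM; congr EFin; lia.
have [exP|noP] := pselect (exists n, P n).
  have [n /asboolP[x x0 Ex] nmin] := ex_minnP exP.
  exists (M - n%:Z)%:E; split; first by exists x.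
  move=> _ [y y0 <-]; have [->|[m /nmin nm ->]] := jumpP y y0; first exact: leNye.
  by rewrite lee_fin; lia.
(* No jump is finite here: the greatest one is [-oo], attained at 1 because [D 1 = 0]. *)
exists -oo%E; split; last first.
  by move=> _ [y y0 <-]; have [->|[m Pm _]] := jumpP y y0; [|case: noP; exists m].
exists 1; first exact/eqP/oner_neq0.
by rewrite der1 (deg_zero hdeg).
Qed.

End BoundedDerivation.

Lemma weighted_degree_tame (K : fieldType) :
  tame (@constants K) (@weighted_degree K).
Proof.
move=> D hD.
have hd := weighted_degree_is_degree_function K.
(* The degree [y] of [D 'X] or [D 'X%:P] may be [-oo], and then any bound serves. *)
have ubd (y : \bar int) (z : int) : y <> +oo%E ->
    exists M, forall N : int, M <= N -> (y <= z%:E + N%:E)%E.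
  case: y => [y| |] // _; last by exists 0 => N _; rewrite leNye.
  by exists (y - z) => N hN; rewrite lee_fin; lia.
have [M1 hM1] := ubd _ 2%:Z (@deg_neq_pinfty _ _ hd (D 'X)).
have [M2 hM2] := ubd _ 3%:Z (@deg_neq_pinfty _ _ hd (D 'X%:P)).
pose M := Num.max M1 M2.
apply: (bounded_derivation_degree_defined hd hD (M := M)) => p.
rewrite /raises_degree_by {1}(bivariate_expansion p) (der_sum hD).
apply: (deg_sum_le hd) => i _; rewrite (der_sum hD); apply: (deg_sum_le hd) => j _.
have [c0|c0] := eqVneq p`_i`_j 0.
  by rewrite c0 !rmorph0 !mul0r (der0 hD) (deg_zero hd) leNye.
set m := _ * _ * _.
have mM : raises_degree_by (@weighted_degree K) D M m.
  apply: (raises_degree_byM hd hD); first apply: (raises_degree_byM hd hD).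
  - by apply: (raises_degree_by0 hd); apply: (der_base hD); exists p`_i`_j.
  - apply: (raises_degree_byX hd hD); rewrite /raises_degree_by weighted_degreeY.
    by apply: hM2; rewrite le_max lexx orbT.
  - apply: (raises_degree_byX hd hD); rewrite /raises_degree_by weighted_degreeX.
    by apply: hM1; rewrite le_max lexx.
(* The absence of cancellation bounds the degree of each monomial of [p] by that of [p]. *)
apply: le_trans mM _; apply: leeD2r.
apply: le_trans (weighted_degree_coef c0).
rewrite /m !(deg_mul hd) weighted_degreeC // add0e.
rewrite (deg_exp hd _ (@weighted_degreeY K)) (deg_exp hd _ (@weighted_degreeX K)).
by rewrite lee_fin; lia.
Qed.

(** * The limit degree *)

Section HornerDegree.
Variables (F : fieldType) (deg : F -> \bar int).
Hypothesis hdeg : is_degree_function deg.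

Lemma deg_exp_le0 y n : (deg y <= 0%:E)%E -> (deg (y ^+ n) <= 0%:E)%E.
Proof.
move=> y0; elim: n => [|n IHn]; first by rewrite expr0 (deg_one hdeg).
by rewrite exprS (deg_mul hdeg) -[leRHS]adde0 leeD.
Qed.

Lemma deg_horner_le (Q : {poly F}) c y :
  (forall i, deg Q`_i <= c)%E -> (deg y <= 0%:E)%E -> (deg Q.[y] <= c)%E.
Proof.
move=> hQ hy; rewrite horner_coef; apply: (deg_sum_le hdeg) => i _.
by rewrite (deg_mul hdeg) -[leRHS]adde0 leeD ?deg_exp_le0.
Qed.

(** An ultrametric Lipschitz estimate: [y - z] divides each [y^i - z^i], with a cofactor of degree
    at most 0. *)
Lemma deg_horner_sub_le (Q : {poly F}) c y z :
  (forall i, deg Q`_i <= c)%E -> (deg y <= 0%:E)%E -> (deg z <= 0%:E)%E ->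
  (deg (Q.[y] - Q.[z]) <= c + deg (y - z)%R)%E.
Proof.
move=> hQ hy hz; rewrite !horner_coef -sumrB.
apply: (deg_sum_le hdeg) => i _; rewrite -mulrBr (deg_mul hdeg) leeD //.
rewrite subrXX (deg_mul hdeg) -[leRHS]adde0 leeD2l //.
apply: (deg_sum_le hdeg) => j _.
by rewrite (deg_mul hdeg) -[leRHS]adde0 leeD ?deg_exp_le0.
Qed.

End HornerDegree.

Lemma horner_clear_denominators (A : idomainType) (q : {poly A}) (w s : A) :
  s != 0 ->
  exists r, (map_poly (@FracField.tofrac A) q).[w%:F / s%:F] * s%:F ^+ size q = r%:F.
Proof.
move=> s0; exists (\sum_(i < size q) q`_i * w ^+ i * s ^+ (size q - i)).
have sF : s%:F != 0 by rewrite tofrac_eq0.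
rewrite (horner_coef_wide _ (n := size q)) ?size_map_poly_leq ?size_poly //.
rewrite mulr_suml rmorph_sum; apply: eq_bigr => i _.
rewrite coef_map !rmorphM !rmorphXn /= -!mulrA; congr (_ * _).
rewrite exprMn -mulrA; congr (_ * _).
by rewrite exprVn -[in X in _ * X](subnK (ltnW (ltn_ord i))) exprD mulrC mulfK ?expf_neq0.
Qed.

(** * Lacunary approximations and stabilization of the degree *)

Section LimitDegree.
Variable K : numFieldType.
Variable a : K.
Local Notation B := {poly {poly K}}.
Local Notation F := {fraction {poly K}}.
Local Notation tofrac := (@FracField.tofrac {poly K}).
Local Notation t := (tofrac 'X).
Local Notation fdeg := (fracdeg (@polydeg K)).

Let hp : is_degree_function (@polydeg K) := polydeg_is_degree_function K.
Let hF : is_degree_function fdeg := fracdeg_is_degree_function hp.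

Lemma t_neq0 : t != 0. Proof. by rewrite tofrac_eq0 polyX_eq0. Qed.

Lemma fdeg_Xn n : fdeg (t ^+ n) = n%:Z%:E.
Proof. by rewrite -tofracXn (fracdeg_tofrac hp) polydeg_Xn. Qed.

Lemma fdeg_XVn n : fdeg (t ^- n) = (- n%:Z)%:E.
Proof.
rewrite -[t ^- n]mul1r -tofracXn -tofrac1 (fracdeg_div hp); last first.
  by apply/eqP; rewrite expf_neq0 ?polyX_eq0.
by rewrite (deg_one hp) polydeg_Xn add0e.
Qed.

(** This is the truncation [v_n]. The exponents are even so that [t^(2 n!) v_n] is a polynomial in
    [t^2], the image of [X]. Since [0! = 1!], the term [t^-2] occurs twice when [n > 0]. *)
Definition approx (n : nat) : F :=
  tofrac a%:P + \sum_(i < n.+1) t ^- (2 * i`!).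

Lemma fdeg_const (c : K) : (fdeg (tofrac c%:P) <= 0%:E)%E.
Proof. by rewrite (fracdeg_tofrac hp) (polydeg_le c%:P 0) size_polyC leq_b1. Qed.

Lemma fdeg_approx_sub_const n : (fdeg (approx n - tofrac a%:P)%R < 0%:E)%E.
Proof.
rewrite /approx addrC addKr; apply: (@le_lt_trans _ _ (-2)%:E) => //.
apply: (deg_sum_le hF) => i _; rewrite fdeg_XVn lee_fin; have := fact_gt0 i; lia.
Qed.

Lemma fdeg_approx_le0 n : (fdeg (approx n) <= 0%:E)%E.
Proof.
rewrite -[approx n](subrK (tofrac a%:P)); apply: le_trans (deg_add hF _ _) _.
by rewrite ge_max fdeg_const ltW ?fdeg_approx_sub_const.
Qed.

Lemma approxS n : approx n.+1 - approx n = t ^- (2 * n.+1`!).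
Proof. by rewrite /approx big_ord_recr /= addrA [X in X - _]addrC addrK. Qed.

(** The difference telescopes into terms of degree [- 2 i!] with [m < i <= n]. *)
Lemma fdeg_approx_sub_le m n : (m <= n)%N ->
  (fdeg (approx n - approx m)%R <= (- (2 * m.+1`!)%:Z)%:E)%E.
Proof.
elim: n => [|n IHn].
  by rewrite leqn0 => /eqP->; rewrite subrr (deg_zero hF) leNye.
rewrite leq_eqVlt => /orP[/eqP->|mn]; first by rewrite subrr (deg_zero hF) leNye.
rewrite -[approx n.+1](subrK (approx n)) -addrA approxS.
apply: le_trans (deg_add hF _ _) _; rewrite ge_max IHn // andbT fdeg_XVn lee_fin.
have := leq_fact mn; lia.
Qed.

(** If [v_n = v_m] with [m < n], then [t^(-2 (m+1)!) = v_(m+1) - v_n], whose degree is at most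
    [- 2 (m+2)!], a contradiction. *)
Lemma approx_inj : injective approx.
Proof.
have H m n : (m < n)%N -> approx n <> approx m.
  move=> mn e; have /(congr1 fdeg) := approxS m.
  have -> : approx m.+1 - approx m = - (approx n - approx m.+1).
    by rewrite e opprB.
  rewrite (deg_opp hF) fdeg_XVn => E.
  have := fdeg_approx_sub_le mn; rewrite E lee_fin (factS m.+1).
  by have := fact_gt0 m.+1; move: (m.+1`!) => f; nia.
move=> m n e; case: (ltngtP m n) => // mn; first by case: (H _ _ mn).
by case: (H _ _ mn).
Qed.

Definition approx_num n : {poly K} :=
  a%:P * 'X^(2 * n`!) + \sum_(i < n.+1) 'X^(2 * n`! - 2 * i`!).

Lemma approxE n : approx n = tofrac (approx_num n) / tofrac 'X^(2 * n`!).
Proof.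
apply: (canRL (mulfK _)); first by rewrite tofracXn expf_neq0 ?t_neq0.
rewrite /approx /approx_num mulrDl rmorphD rmorphM; congr (_ + _).
rewrite mulr_suml rmorph_sum; apply: eq_bigr => i _; rewrite !rmorphXn /=.
have h : (2 * i`! <= 2 * n`!)%N by have := leq_fact (ltn_ord i : (i <= n)%N); lia.
by rewrite -[X in _ * t ^+ X](subnK h) exprD mulrC mulfK ?expf_neq0 ?t_neq0.
Qed.

(* The polynomial p(t^2, u t^3) in the variable u, with coefficients in K(t). *)
Definition value_poly (p : B) : {poly F} :=
  map_poly tofrac (swapXY (weight_subst p)).

Lemma value_poly_eq0 p : value_poly p = 0 -> p = 0.
Proof.
have inj : injective tofrac by move=> x y /eqP; rewrite tofrac_eq => /eqP.
move=> h; apply: weight_subst_eq0; apply/eqP; rewrite -swapXY_eq0; apply/eqP.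
by apply: (map_inj_poly inj (rmorph0 tofrac)); rewrite rmorph0.
Qed.

(** After the swap, the coefficient of [u^i] is a polynomial in [t], of degree at most that of the
    whole in [t]. *)
Lemma fdeg_value_poly_coef p i : (fdeg (value_poly p)`_i <= weighted_degree p)%E.
Proof.
rewrite coef_map (fracdeg_tofrac hp) /weighted_degree.
set q := weight_subst p; rewrite {2}/polydeg; case: eqVneq => [->|q0].
  by rewrite rmorph0 coef0 (deg_zero hp).
rewrite polydeg_le; apply: leq_trans (max_size_coefXY _ _) _.
by rewrite sizeYE swapXYK leqSpred.
Qed.

Lemma value_poly_zmod : zmod_morphism value_poly.
Proof.
move=> p q; rewrite /value_poly weight_subst_zmod.
by rewrite swapXY_is_zmod_morphism (raddfB (map_poly tofrac)).
Qed.

Lemma value_poly_monoid : monoid_morphism value_poly.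
Proof.
split=> [|p q]; rewrite /value_poly.
  by rewrite (rmorph1 (@weight_subst K)) (rmorph1 (@swapXY _)) (rmorph1 (map_poly tofrac)).
by rewrite (rmorphM (@weight_subst K)) (rmorphM (@swapXY _)) (rmorphM (map_poly tofrac)).
Qed.

Definition value (n : nat) (p : B) : F := (value_poly p).[approx n].

Lemma value_zmod n : zmod_morphism (value n).
Proof. by move=> p q; rewrite /value value_poly_zmod hornerD hornerN. Qed.

Lemma value_monoid n : monoid_morphism (value n).
Proof.
have [v1 vM] := value_poly_monoid.
by split=> [|p q]; rewrite /value ?v1 ?hornerC // vM hornerM.
Qed.

HB.instance Definition _ n :=
  GRing.isZmodMorphism.Build B F (value n) (value_zmod n).
HB.instance Definition _ n :=
  GRing.isMonoidMorphism.Build B F (value n) (value_monoid n).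

Lemma valueC n c : value n c%:P%:P = tofrac c%:P.
Proof.
by rewrite /value /value_poly weight_substC swapXY_polyC map_polyC map_polyC hornerC.
Qed.

Lemma valueX n : value n 'X = t ^+ 2.
Proof.
by rewrite /value /value_poly weight_substX rmorphXn /= swapXY_X rmorphXn /= map_polyC
  horner_exp hornerC.
Qed.

Lemma valueY n : value n 'X%:P = approx n * t ^+ 3.
Proof.
rewrite /value /value_poly weight_substY rmorphM rmorphXn /= swapXY_X swapXY_Y.
by rewrite rmorphM rmorphXn /= map_polyC map_polyX hornerM hornerX horner_exp hornerC.
Qed.

(** The lower bound in Liouville's argument: clearing denominators by a power of [t^(2 n!)] leaves a
    nonzero polynomial in [t], of degree at least 0. *)
Lemma fdeg_value_ge n p : value n p != 0 ->
  ((- (2 * n`! * size (swapXY (weight_subst p)))%:Z)%:E <= fdeg (value n p))%E.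
Proof.
move=> v0; have X0 : 'X^(2 * n`!) != 0 :> {poly K}.
  by rewrite expf_neq0 ?polyX_eq0.
have [r] := horner_clear_denominators (swapXY (weight_subst p)) (approx_num n) X0.
rewrite -approxE -/(value_poly p) -/(value n p) => Er.
have /eqP r0 : tofrac r != 0.
  by rewrite -Er; apply: (mulf_neq0 v0); apply: expf_neq0; rewrite tofrac_eq0.
have := congr1 fdeg Er; rewrite (deg_mul hF) tofracXn -exprM fdeg_Xn.
rewrite (fracdeg_tofrac hp); have [z ->] := deg_fin hF (elimN eqP v0).
by rewrite /polydeg; case: eqVneq => // _ [] h; rewrite lee_fin -subr_ge0 opprK h.
Qed.

(* With Q := value_poly p and k := size Q, a nonzero Q(v_n) has degree at least
   - 2 k n!, while Q(v_(n+1)) - Q(v_n) has degree at most a constant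
   minus 2 (n+1)!, which is smaller for large n. *)
Lemma value_stabilizes p : p != 0 ->
  exists N, forall n, (N <= n)%N ->
    value n p != 0 /\ fdeg (value n p) = fdeg (value N p).
Proof.
move=> p0; have hw := weighted_degree_is_degree_function K.
have [c Ec] := deg_fin hw (elimN eqP p0).
set k := size (swapXY (weight_subst p)).
(* For [n >= N0], [n + 1 - k > |c|], hence [c - 2 (n+1)! < - 2 k n!]. *)
pose N0 := (k + `|c|)%N.
have step n : (N0 <= n)%N -> value n p != 0 ->
    fdeg (value n.+1 p) = fdeg (value n p).
  move=> Nn v0; rewrite -[value n.+1 p](subrK (value n p)) addrC.
  apply: (deg_addl hF); apply: lt_le_trans (fdeg_value_ge v0).
  apply: le_lt_trans (deg_horner_sub_le hF (fdeg_value_poly_coef p) _ _) _;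
    try exact: fdeg_approx_le0.
  rewrite approxS fdeg_XVn Ec lte_fin -/k factS; have := fact_gt0 n.
  by move: (n`!) => f; rewrite /N0 in Nn; nia.
(* Otherwise [value_poly p] would vanish at as many distinct [v_n] as its size, which exceeds its
   degree. *)
have [N NN vN] : exists2 N, (N0 <= N)%N & value N p != 0.
  apply: contrapT => H; have Qp0 : value_poly p != 0.
    by apply: contra_neq p0 => /value_poly_eq0.
  pose s := [seq approx n | n <- iota N0 (size (value_poly p))].
  have rs : all (root (value_poly p)) s.
    apply/allP => _ /mapP[n nN ->]; apply/negPn/negP => nr; apply: H.
    by exists n; move: nN; rewrite mem_iota // => /andP[].
  have := max_poly_roots Qp0 rs; rewrite size_map size_iota ltnn.
  by rewrite (map_inj_uniq approx_inj) iota_uniq => /(_ isT).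
exists N => n; elim: n => [|n IHn].
  by rewrite leqn0 => /eqP N_0; rewrite -N_0.
rewrite leq_eqVlt => /orP[/eqP<-//|]; rewrite ltnS => Nn.
have [vn En] := IHn Nn; have Es := step n (leq_trans NN Nn) vn.
split; last by rewrite Es.
(* Equality of degrees carries nonvanishing from [n] to [n.+1]. *)
apply: contra_neq vn => v0; apply/(deg_ninftyP hF).
by rewrite -Es v0 (deg_zero hF).
Qed.

Lemma limit_exists p :
  exists z, exists N, forall n, (N <= n)%N -> fdeg (value n p) = z.
Proof.
have [->|/value_stabilizes[N hN]] := eqVneq p 0.
  by exists -oo%E, 0%N => n _; rewrite rmorph0 (deg_zero hF).
by exists (fdeg (value N p)), N => n /hN[].
Qed.

Definition limit_degree p := projT1 (cid (limit_exists p)).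

Lemma limit_degreeP p :
  exists N, forall n, (N <= n)%N -> fdeg (value n p) = limit_degree p.
Proof. exact: projT2 (cid (limit_exists p)). Qed.

Lemma limit_degreeE p N z :
  (forall n, (N <= n)%N -> fdeg (value n p) = z) -> limit_degree p = z.
Proof.
move=> H; have [M hM] := limit_degreeP p.
by rewrite -(hM (maxn M N)) ?leq_maxl // H // leq_maxr.
Qed.

Lemma limit_degree_is_degree_function : is_degree_function limit_degree.
Proof.
split.
- move=> p; have [N /(_ N (leqnn _)) <-] := limit_degreeP p.
  exact: (deg_neq_pinfty hF).
- move=> p; split=> [|->]; last first.
    by apply: (@limit_degreeE _ 0) => n _; rewrite rmorph0 (deg_zero hF).
  have [->//|/value_stabilizes[N hN]] := eqVneq p 0.
  have [M hM] := limit_degreeP p; rewrite -(hM (maxn M N)) ?leq_maxl //.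
  move=> /(deg_ninftyP hF) E; have [] := hN (maxn M N) (leq_maxr _ _).
  by rewrite E eqxx.
- move=> p q; have [N hN] := limit_degreeP p; have [M hM] := limit_degreeP q.
  apply: (@limit_degreeE _ (maxn N M)) => n; rewrite geq_max => /andP[Nn Mn].
  rewrite (rmorphM (value n)) (deg_mul hF).
  by congr (_ + _)%E; [exact: hN|exact: hM].
- move=> p q; have [N hN] := limit_degreeP p; have [M hM] := limit_degreeP q.
  have [L hL] := limit_degreeP (p + q); pose n := maxn L (maxn N M).
  rewrite -(hL n) ?leq_maxl // -(hN n) -?(hM n) /n ?leq_max ?leqnn ?orbT //.
  by rewrite (rmorphD (value n)) (deg_add hF).
Qed.

End LimitDegree.

Lemma weight_subst_map (K L : fieldType) (f : {rmorphism K -> L}) p :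
  weight_subst (map_poly (map_poly f) p) = map_poly (map_poly f) (weight_subst p).
Proof.
apply/polyP => n; apply/polyP => l; rewrite !coef_map coef_weight_subst.
rewrite /= coef_weight_subst size_map_inj_poly ?rmorph0 //; last first.
  exact: map_inj_poly (fmorph_inj f) (rmorph0 f).
by rewrite rmorph_sum; apply: eq_bigr => i _; rewrite !coef_map rmorphMn.
Qed.

(** * Agreement on rational polynomials, and wildness *)

Section LimitDegreeProperties.
Variable K : numFieldType.
Variable a : K.
Local Notation B := {poly {poly K}}.
Local Notation tofrac := (@FracField.tofrac {poly K}).
Local Notation fdeg := (fracdeg (@polydeg K)).

Let hp : is_degree_function (@polydeg K) := polydeg_is_degree_function K.
Let hF : is_degree_function fdeg := fracdeg_is_degree_function hp.
Let hd : is_degree_function (limit_degree a) := limit_degree_is_degree_function a.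

Lemma limit_degreeC c : c != 0 -> limit_degree a c%:P%:P = 0%:E.
Proof.
move=> c0; apply: (@limit_degreeE _ _ _ 0) => n _.
by rewrite valueC (fracdeg_tofrac hp) polydeg_C.
Qed.

Lemma limit_degreeX : limit_degree a 'X = 2%:Z%:E.
Proof. by apply: (@limit_degreeE _ _ _ 0) => n _; rewrite valueX fdeg_Xn. Qed.

Lemma fdeg_approx n : a != 0 -> fdeg (approx a n) = 0%:E.
Proof.
move=> a0; have Ea : fdeg (tofrac a%:P) = 0%:E by rewrite (fracdeg_tofrac hp) polydeg_C.
rewrite -[approx a n](subrK (tofrac a%:P)) addrC (deg_addl hF) ?Ea //.
exact: fdeg_approx_sub_const.
Qed.

Lemma limit_degreeY : a != 0 -> limit_degree a 'X%:P = 3%:Z%:E.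
Proof.
move=> a0; apply: (@limit_degreeE _ _ _ 0) => n _.
by rewrite valueY (deg_mul hF) fdeg_Xn fdeg_approx // add0e.
Qed.

(** The hypothesis says that putting [u = a] keeps the degree in [t]. Replacing [a] by [v_n] then
    changes the value only by an element of smaller degree. *)
Lemma limit_degree_weighted p :
  (lead_coef (weight_subst p)).[a] != 0 -> limit_degree a p = weighted_degree p.
Proof.
move=> lc0; apply: (@limit_degreeE _ _ _ 0) => n _.
set q := weight_subst p in lc0.
have q0 : q != 0 by apply: contra_neq lc0 => ->; rewrite lead_coef0 horner0.
have Ea : fdeg (value_poly p).[tofrac a%:P] = weighted_degree p.
  rewrite /value_poly horner_map (fracdeg_tofrac hp) horner_swapXY -/q.
  rewrite /weighted_degree -/q /polydeg (negbTE q0).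
  rewrite -lead_coef_eq0 lead_coef_map_eq ?(negbTE lc0) //.
  by rewrite size_poly_eq.
rewrite /value -[(value_poly p).[_]](subrK (value_poly p).[tofrac a%:P]) addrC.
rewrite (deg_addl hF) //; apply: le_lt_trans.
  apply: (deg_horner_sub_le hF (fdeg_value_poly_coef p)).
    exact: fdeg_approx_le0.
  exact: fdeg_const.
rewrite Ea; have := fdeg_approx_sub_const a n.
have hw := weighted_degree_is_degree_function K.
have /eqP/(deg_fin hw)[z ->] : p != 0.
  by apply: contra_neq q0 => p0; rewrite /q p0 rmorph0.
case: (fdeg _) => [u| |] //; last by move=> _; exact: ltNyr.
by rewrite -EFinD !lte_fin; lia.
Qed.

(** The leading coefficient in [t] comes from a nonzero rational polynomial in [u], which cannot
    vanish at [a]. *)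
Lemma limit_degree_rat (q : {poly {poly rat}}) :
  (forall r : {poly rat}, r != 0 -> (map_poly ratr r).[a] != 0) ->
  weighted_degree (map_poly (map_poly (@ratr K)) q) =
  limit_degree a (map_poly (map_poly (@ratr K)) q).
Proof.
move=> trans; have [->|q0] := eqVneq q 0.
  rewrite rmorph0 (deg_zero hd).
  exact: (deg_zero (weighted_degree_is_degree_function K)).
rewrite limit_degree_weighted // weight_subst_map.
rewrite lead_coef_map_inj ?rmorph0 //; last first.
  exact: map_inj_poly (fmorph_inj _) (rmorph0 _).
apply: trans; rewrite lead_coef_eq0; apply: contra_neq q0; exact: weight_subst_eq0.
Qed.

(** Differentiating the coefficients is [d/dY], since [Y] is the inner variable. *)
Lemma map_deriv_is_derivation :
  is_derivation_over (@constants K) (map_poly (@deriv K) : B -> B).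
Proof.
have cE (p : B) i : (map_poly (@deriv K) p)`_i = (p`_i)^`().
  by rewrite coef_map_id0 ?deriv0.
split.
- by move=> p q; apply/polyP => i; rewrite coefD !cE coefD derivD.
- move=> p q; apply/polyP => i; rewrite coefD cE !coefM -big_split raddf_sum.
  by apply: eq_bigr => j _; rewrite !cE /= derivM.
- by move=> _ [c _ <-]; apply/polyP => i; rewrite cE coefC coef0; case: ifP => _;
    rewrite ?derivC ?deriv0.
Qed.

Definition approx_numX n : {poly K} :=
  a%:P * 'X^(n`!) + \sum_(i < n.+1) 'X^(n`! - i`!).

(* X^(2 n!) Y^2 - X^3 w_n^2, with w_n = X^(n!) v_n in K[X]. *)
Definition key_poly n : B :=
  ('X ^+ (2 * n`!))^:P * 'X%:P ^+ 2 - ('X ^+ 3 * approx_numX n ^+ 2)^:P.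

Lemma value_approx_numX m n :
  value a m (approx_numX n)^:P = tofrac 'X ^+ (2 * n`!) * approx a n.
Proof.
rewrite [RHS]mulrC /approx /approx_numX.
rewrite (rmorphD (map_poly (@polyC K))).
rewrite (rmorphD (value a m)).
rewrite (rmorphM (map_poly (@polyC K))).
rewrite (rmorph_sum (map_poly (@polyC K))).
rewrite (rmorphM (value a m)).
rewrite (rmorph_sum (value a m)).
rewrite /= map_polyC map_polyXn valueC.
rewrite (rmorphXn (value a m)) /= valueX.
rewrite mulrDl -exprM; congr (_ + _); rewrite mulr_suml; apply: eq_bigr => i _.
rewrite map_polyXn (rmorphXn (value a m)) /= valueX -exprM mulnBr.
have h : (2 * i`! <= 2 * n`!)%N.
  by have := leq_fact (ltn_ord i : (i <= n)%N); lia.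
by rewrite -[X in _ * _ ^+ X](subnK h) exprD mulrC mulfK ?expf_neq0 ?t_neq0.
Qed.

(** Both terms share the factor [t^(4 n! + 6)], which leaves the difference of squares
    [v_m^2 - v_n^2]. *)
Lemma value_key_poly m n :
  value a m (key_poly n) =
  tofrac 'X ^+ (4 * n`! + 6) * ((approx a m - approx a n) * (approx a m + approx a n)).
Proof.
rewrite /key_poly map_polyXn.
rewrite (rmorphM (map_poly (@polyC K))) /= map_polyXn.
rewrite (rmorphXn (map_poly (@polyC K))) /=.
rewrite value_zmod.
rewrite !(value_monoid a m).2.
rewrite !(rmorphXn (value a m)) /= valueX valueY value_approx_numX.
have -> : (4 * n`! + 6 = 2 * n`! + 2 * n`! + 6)%N by lia.
move: (2 * n`!)%N (approx a m) (approx a n) (tofrac 'X) => e v w t.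
rewrite exprD (exprD t e e) (exprAC t 2 e).
by move: (t ^+ e : {fraction {poly K}}) => u; ring.
Qed.

Lemma limit_degree_key_poly n :
  (limit_degree a (key_poly n) <=
     ((4 * n`! + 6)%:Z - (2 * n.+1`!)%:Z)%:E)%E.
Proof.
have [N hN] := limit_degreeP a (key_poly n).
rewrite -(hN (maxn N n)) ?leq_maxl // value_key_poly (deg_mul hF) fdeg_Xn EFinB.
apply: leeD2l; rewrite (deg_mul hF) -[leRHS]adde0; apply: leeD.
  by apply: fdeg_approx_sub_le; rewrite leq_maxr.
apply: le_trans (deg_add hF _ _) _; rewrite ge_max.
by apply/andP; split; apply: fdeg_approx_le0.
Qed.

Lemma map_deriv_key_poly n :
  map_poly (@deriv K) (key_poly n) = (2%:R : K)%:P%:P * 'X ^+ (2 * n`!) * 'X%:P.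
Proof.
have hD := map_deriv_is_derivation.
have D0 (q : {poly K}) : map_poly (@deriv K) q^:P = 0.
  apply/polyP => i; rewrite coef_map_id0 ?deriv0 // coef_map_id0 // coef0.
  by rewrite derivC.
have DN (p : B) : map_poly (@deriv K) (- p) = - map_poly (@deriv K) p.
  by apply/eqP; rewrite -addr_eq0 -(der_add hD) addNr (der0 hD).
rewrite /key_poly (der_add hD) DN D0 subr0 (der_mul hD) D0 mul0r add0r.
rewrite expr2 (der_mul hD) (map_polyC (@deriv K)) /= derivX mulr1 mul1r map_polyXn.
by rewrite (rmorph_nat (@polyC K)) (rmorph_nat (@polyC _)) -mulrA mulr_natl mulr2n mulrDr.
Qed.

Lemma limit_degree_wild : a != 0 -> wild (@constants K) (limit_degree a).
Proof.
move=> a0 /(_ _ map_deriv_is_derivation)[u [[p /(deg_fin hd)[z Ep] Eu] ub]].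
have u_fin : u <> +oo%E.
  rewrite -Eu Ep; case E: (limit_degree a _) => [w| |] //.
  by case: (deg_neq_pinfty hd E).
(* The jump at [key_poly n] is at least [(4 n! + 3) - (4 n! + 6 - 2 (n+1)!)]. *)
have jump n : (((2 * n.+1`!)%:Z - 3)%:E <= u)%E.
  have key0 : key_poly n <> 0.
    move=> k0; have := map_deriv_key_poly n; rewrite k0 (der0 map_deriv_is_derivation).
    apply/eqP; rewrite eq_sym !mulf_neq0 ?polyC_eq0 ?expf_neq0 ?polyX_eq0 //.
    by rewrite pnatr_eq0.
  apply: (@le_trans _ _ (limit_degree a (map_poly (@deriv K) (key_poly n)) -
      limit_degree a (key_poly n))%E); last by apply: ub; exists (key_poly n).
  have [w Ew] := deg_fin hd key0; have := limit_degree_key_poly n.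
  rewrite map_deriv_key_poly !(deg_mul hd) limit_degreeC ?pnatr_eq0 //.
  rewrite (deg_exp hd _ limit_degreeX) limit_degreeY // Ew add0e !lee_fin.
  by move: (n.+1`!) (n`!) => f g; lia.
case: u u_fin jump {Eu ub} => [u| |] // _ jump; last by have := jump 0%N.
(* With [n = |u + 3|], [2 (n+1)! >= 2 (n+1) > u + 3], contradicting [jump n]. *)
have := jump (absz (u + 3)); rewrite lee_fin; have := fact_geq (absz (u + 3)).+1.
by move: (_`!) => f; lia.
Qed.

End LimitDegreeProperties.

(** * Transcendental numbers *)

Lemma finite_roots (K : closedFieldType) (p : {poly K}) :
  p != 0 -> finite_set [set x | root p x].
Proof.
move=> p0; have [rs Ep] := closed_field_poly_normal p.
apply: sub_finite_set (finite_seq rs) => x /=.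
by rewrite Ep rootZ ?lead_coef_eq0 // root_prod_XsubC.
Qed.

(** The real algebraic numbers are countable, hence of Lebesgue measure 0, and cannot cover
    [[1, 2]]. This interval also keeps [a] away from 0. *)
Lemma exists_transcendental (R : realType) :
  exists2 a : R[i], a != 0 & forall p : {poly rat}, p != 0 -> (map_poly ratr p).[a] != 0.
Proof.
apply: contrapT => H.
pose alg := \bigcup_(p in [set p : {poly rat} | p != 0])
  [set r : R | root (map_poly ratr p) (r%:C)%C].
have alg_countable : countable alg.
  apply: bigcup_countable => [|p /= p0]; first exact: countableP.
  apply: finite_set_countable.
  have p1 : map_poly (@ratr R[i]) p != 0 by rewrite map_poly_eq0.
  (* Real roots are among the real parts of the finitely many complex roots. *)
  apply: (sub_finite_set _ (finite_image (@complex.Re R) (finite_roots p1))).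
  by move=> r /= pr; exists (r%:C)%C.
have sub : [set` `[1, 2] : interval R] `<=` alg.
  move=> r /=; rewrite in_itv /= => /andP[r1 _]; apply: contrapT => nr; apply: H.
  exists (r%:C)%C.
    rewrite fmorph_eq0; apply: lt0r_neq0; exact: lt_le_trans r1.
  by move=> p p0; apply: contra_notN nr => pr; exists p.
have := countable_lebesgue_measure0 (sub_countable (subset_card_le sub) alg_countable).
rewrite lebesgue_measure_itv /= lte_fin ltr1n -EFinB => -[] /eqP.
by rewrite subr_eq0 pnatr_eq1.
Qed.

Theorem corollary1p6 (R : realType) :
  exists d d' : {poly {poly R[i]}} -> \bar int,
    [/\ S_set d, S_set d',
        forall q : {poly {poly rat}}, d (ratr_poly2 R q) = d' (ratr_poly2 R q),
        tame (@constants R[i]) d &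
        wild (@constants R[i]) d'].
Proof.
have [a a0 trans] := exists_transcendental R.
exists (@weighted_degree R[i]), (limit_degree a); split.
- split; first exact: weighted_degree_is_degree_function.
  + by move=> c /eqP; exact: weighted_degreeC.
  + exact: weighted_degreeX.
  + exact: weighted_degreeY.
- split; first exact: limit_degree_is_degree_function.
  + by move=> c /eqP; exact: limit_degreeC.
  + exact: limit_degreeX.
  + exact: limit_degreeY.
- by move=> q; exact: limit_degree_rat.
- exact: weighted_degree_tame.
- exact: limit_degree_wild.
Qed.
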